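(* Let $(\Lambda,\to_{p})$ be a pure calculus and $(\Lambda^X,\to)$ a calculus with explicit substitutions with $\Lambda\subset\Lambda^X$. Let the reduction rules of the latter be split into two disjoint sets $R_1$ and $R_2$, where the reduction $\to_{R_1}$ is terminating. Let $T$ be a typing system for the pure calculus and $T'$ a typing system for the calculus with explicit substitutions, and assume that every pure term typable with respect to $T$ is strongly normalizing in the pure calculus. Suppose that there exist a function $\mathit{Ateb}:\Lambda^X\to\Lambda$ and a binary relation $\mathcal{R}$ on $\Lambda^X$ such that: (Preservation of typability) for every $t\in\Lambda^X$ typable with respect to $T'$, the pure term $\mathit{Ateb}(t)$ is typable with respect to $T$ in the pure calculus; (Initialisation) for every typed term $t\in\Lambda^X$ (with respect to $T'$), there exists a term $u$ with $u\,\mathcal{R}\,t$ such that $\mathit{Ateb}(t)\to^* u$; (Simulation $^*$) for every term $t\in\Lambda^X$, if $t\to_{R_1}t'$ then for every $u\,\mathcal{R}\,t$ there exists $u'$ such that $u\to^* u'$ and $u'\,\mathcal{R}\,t'$; (Simulation $^+$) for every term $t\in\Lambda^X$, if $t\to_{R_2}t'$ then for every $u\,\mathcal{R}\,t$ there exists $u'$ such that $u\to^+ u'$ and $u'\,\mathcal{R}\,t'$. Then PSN implies SN with respect to $T'$. That is, if every pure term that is strongly normalizing for $\to_p$ is strongly normalizing for $\to$, then every term of $\Lambda^X$ typable with respect to $T'$ is strongly normalizing for $\to$.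
   Context: A calculus is a set of terms with a reduction relation. A pure calculus $(\Lambda,\to_p)$ has no explicit substitutions. A calculus with explicit substitutions $(\Lambda^X,\to)$ has as terms a set $\Lambda^X$ containing the pure terms $\Lambda$, and $\to\;=\;\to_{R_1}\cup\to_{R_2}$. $\to^*$ means zero or more steps of $\to$, and $\to^+$ one or more steps. A typing system singles out a subset of typable (typed) terms. A term is strongly normalizing for a reduction relation if there is no infinite reduction sequence starting from it. PSN: every pure term strongly normalizing in the pure calculus is strongly normalizing in the calculus with explicit substitutions. SN (with respect to a typing system): every typable term is strongly normalizing in the calculus with explicit substitutions. *)

(* Defs.v *)
From Stdlib Require Import Relations.

Set Implicit Arguments.

Record calculus : Type := Calculus {
  term :> Type;
  step : relation term
}.

Definition strongly_normalizing (A : Type) (R : relation A) (t : A) : Prop :=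
  ~ exists f : nat -> A, f 0 = t /\ forall n : nat, R (f n) (f (S n)).

Definition terminating (A : Type) (R : relation A) : Prop :=
  forall t : A, strongly_normalizing R t.

Definition typing_system (C : calculus) : Type := term C -> Prop.

(* The inclusion of the pure terms in the terms with explicit substitutions is
   an injection [incl].  Reduction rules are indexed by [rule], so that two
   disjoint sets of rules may still generate a common reduction step;
   [rule_step r] is the reduction generated by [r], with any closure under
   contexts already included. *)
Record es_calculus (P : calculus) : Type := EsCalculus {
  xterm : Type;
  incl : term P -> xterm;
  incl_inj : forall t u : term P, incl t = incl u -> t = u;
  rule : Type;
  rule_step : rule -> relation xterm
}.

Definition step_by (P : calculus) (X : es_calculus P) (S : rule X -> Prop) :
    relation (xterm X) :=
  fun t t' => exists r : rule X, S r /\ rule_step X r t t'.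

Definition es_calculus_calculus (P : calculus) (X : es_calculus P) : calculus :=
  Calculus (step_by X (fun _ => True)).

Coercion es_calculus_calculus : es_calculus >-> calculus.

Definition splits_rules (P : calculus) (X : es_calculus P)
    (R1 R2 : rule X -> Prop) : Prop :=
  (forall r : rule X, R1 r \/ R2 r) /\ (forall r : rule X, ~ (R1 r /\ R2 r)).

Definition PSN (P : calculus) (X : es_calculus P) : Prop :=
  forall t : term P,
    strongly_normalizing (step P) t ->
    strongly_normalizing (step X) (incl X t).

Definition SN (C : calculus) (T : typing_system C) : Prop :=
  forall t : term C, T t -> strongly_normalizing (step C) t.

(* Main.v *)
(* Along an infinite reduction from a typed term t, the terms related to it
   start at a reduct u of Ateb t and reduce to one another, strictly at every
   R2 step; infinitely many steps are R2 steps because R1 terminates.  Hence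
   Ateb t would have an infinite reduction too, against PSN.  The argument is
   run as an induction on the accessibility of u, lexicographically combined
   with the R1-accessibility of the term it is related to. *)

Require Import Defs.
From Stdlib Require Import Relations Wellfounded Classical ClassicalEpsilon.

Lemma Acc_strongly_normalizing (A : Type) (R : relation A) (t : A) :
  Acc (transp A R) t -> strongly_normalizing R t.
Proof.
  induction 1 as [t _ IH]. intros [f [f0 fstep]].
  apply (IH (f 1)).
  - unfold transp. rewrite <- f0. apply fstep.
  - exists (fun n => f (S n)). auto.
Qed.

(** By classical logic, an inaccessible term has an inaccessible successor; choice makes this a
    function [succ], and iterating it from [t] gives an infinite reduction. *)
Lemma strongly_normalizing_Acc (A : Type) (R : relation A) (t : A) :
  strongly_normalizing R t -> Acc (transp A R) t.
Proof.
  intros Hsn. apply NNPP. intros Hacc. apply Hsn.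
  set (B := {x : A | ~ Acc (transp A R) x}).
  assert (succ : forall x : B, {y : B | R (proj1_sig x) (proj1_sig y)}).
  { intros [x Hx]. apply constructive_indefinite_description.
    apply NNPP. intros Hno. apply Hx. constructor. intros y Hxy.
    apply NNPP. intros Hy. apply Hno. exists (exist _ y Hy). exact Hxy. }
  set (g := nat_rect (fun _ => B) (exist _ t Hacc)
              (fun _ x => proj1_sig (succ x))).
  exists (fun n => proj1_sig (g n)). split; [reflexivity |].
  intros n. exact (proj2_sig (succ (g n))).
Qed.

Lemma clos_refl_trans_cases (A : Type) (R : relation A) (x y : A) :
  clos_refl_trans A R x y -> x = y \/ clos_trans A R x y.
Proof.
  induction 1 as [x y H | x | x y z _ [<- | Hxy] _ [<- | Hyz]];
    eauto using t_step, t_trans.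
Qed.

Lemma clos_trans_transp (A : Type) (R : relation A) (x y : A) :
  clos_trans A R x y -> clos_trans A (transp A R) y x.
Proof.
  induction 1; [apply t_step | eapply t_trans]; eassumption.
Qed.

(** Lets the induction on the simulating term descend by several steps at once. *)
Lemma Acc_transp_clos_trans (A : Type) (R : relation A) (x : A) :
  Acc (transp A R) x -> Acc (transp A (clos_trans A R)) x.
Proof.
  intros H. apply Acc_clos_trans in H.
  apply Acc_incl with (2 := H). intros y z. apply clos_trans_transp.
Qed.

Lemma Acc_clos_refl_trans (A : Type) (R : relation A) (x y : A) :
  Acc (transp A R) x -> clos_refl_trans A R x y -> Acc (transp A R) y.
Proof.
  intros Hx Hxy. revert Hx.
  induction Hxy; auto. intros Hx. exact (Acc_inv Hx H).
Qed.

Lemma Acc_simulation (A B : Type) (R1 R2 : relation A) (S : relation B)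
    (Rel : B -> A -> Prop) :
  (forall t, Acc (transp A R1) t) ->
  (forall t t', R1 t t' -> forall u, Rel u t ->
     exists u', clos_refl_trans B S u u' /\ Rel u' t') ->
  (forall t t', R2 t t' -> forall u, Rel u t ->
     exists u', clos_trans B S u u' /\ Rel u' t') ->
  forall u, Acc (transp B S) u -> forall t, Rel u t ->
  Acc (transp A (union A R1 R2)) t.
Proof.
  intros HR1 sim1 sim2 u Hu. apply Acc_transp_clos_trans in Hu.
  induction Hu as [u _ IHu]. intros t.
  (* Here [u] is fixed and [IHu] holds for all [t]; as [HR1] covers every term, this inner induction
     can restart at any [t'] once [u] has decreased. *)
  induction (HR1 t) as [t _ IHt]. intros Hut.
  constructor. intros t' [Htt' | Htt'].
  - destruct (sim1 _ _ Htt' _ Hut) as [u' [Huu' Hu't']].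
    (* If the simulation takes no step, [u] stays and [t] descends along [R1]; otherwise [u]
       descends. *)
    apply clos_refl_trans_cases in Huu' as [<- | Huu'].
    + exact (IHt t' Htt' Hu't').
    + exact (IHu u' Huu' t' Hu't').
  - destruct (sim2 _ _ Htt' _ Hut) as [u' [Huu' Hu't']].
    exact (IHu u' Huu' t' Hu't').
Qed.

Theorem theorem2p7
  (P : calculus) (X : es_calculus P)
  (R1 R2 : rule X -> Prop)
  (Hsplit : splits_rules X R1 R2)
  (HR1 : terminating (step_by X R1))
  (T : typing_system P) (T' : typing_system X)
  (HT : SN T)
  (Ateb : term X -> term P)
  (Rel : relation (term X))
  (preservation_of_typability : forall t : term X, T' t -> T (Ateb t))
  (initialisation : forall t : term X, T' t ->
     exists u : term X,
       Rel u t /\ clos_refl_trans (term X) (step X) (incl X (Ateb t)) u)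
  (simulation_star : forall t t' : term X, step_by X R1 t t' ->
     forall u : term X, Rel u t ->
     exists u' : term X, clos_refl_trans (term X) (step X) u u' /\ Rel u' t')
  (simulation_plus : forall t t' : term X, step_by X R2 t t' ->
     forall u : term X, Rel u t ->
     exists u' : term X, clos_trans (term X) (step X) u u' /\ Rel u' t') :
  PSN X -> SN T'.
Proof.
  intros Hpsn t Ht.
  destruct (initialisation t Ht) as [u [Hut Hu]].
  (* [Ateb t] is typable, so strongly normalizing for the pure reduction, and by PSN for that of
     [X]; its reduct [u] inherits this. *)
  assert (Hacc : Acc (transp _ (step X)) u).
  { apply Acc_clos_refl_trans with (2 := Hu).
    apply strongly_normalizing_Acc, Hpsn, HT.
    exact (preservation_of_typability t Ht). }
  apply Acc_strongly_normalizing.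
  (* Every rule lies in [R1] or [R2], so each step of [X] belongs to the union. *)
  apply Acc_incl with
    (R2 := transp _ (union _ (step_by X R1) (step_by X R2))).
  - intros y x [r [_ Hr]].
    destruct (proj1 Hsplit r); [left | right]; exists r; auto.
  - apply Acc_simulation with (S := step X) (Rel := Rel) (u := u); auto.
    intros x. apply strongly_normalizing_Acc, HR1.
Qed.
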